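(* Let $I\subset\mathbb{R}$ be an open interval, let $\gamma:I\to\mathbb{R}$ be a smooth function, let $\delta$ be a nonzero real constant, and let $\mathcal{F}$ be a smooth real-valued function of two real variables. Let $x(t),y(t),z(t)$ be three linearly independent (smooth, real-valued) solutions on $I$ of the homogeneous third-order linear ODE $$u'''+\gamma(t)u'+\delta u=0,$$ such that $W(x,y,z)(t)\neq 0$ and $W(x',y',z')(t)\neq 0$ for all $t\in I$. Let $C_0$ denote the constant value of $W(x,y,z)(t)$ on $I$. If the compatibility condition $\mathcal{G}(C_0;\delta)=0$ holds, where $\mathcal{G}(w;\delta):=\mathcal{F}(w,-\delta w)$, then $x,y,z$ satisfy the nonlinear differential equation $$\mathcal{F}\left(W(x,y,z)(t),\,W(x',y',z')(t)\right)=0\quad\text{for all } t\in I.$$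
   Context: For smooth functions $x,y,z$ on an open interval $I$, the Wronskian is $$W(x,y,z)(t)=\begin{vmatrix} x(t)&y(t)&z(t)\\ x'(t)&y'(t)&z'(t)\\ x''(t)&y''(t)&z''(t)\end{vmatrix},$$ and the Wronskian of the first derivatives is $$W(x',y',z')(t)=\begin{vmatrix} x'(t)&y'(t)&z'(t)\\ x''(t)&y''(t)&z''(t)\\ x'''(t)&y'''(t)&z'''(t)\end{vmatrix}.$$ For solutions $x,y,z$ of $u'''+\gamma(t)u'+\delta u=0$ the Wronskian $W(x,y,z)(t)$ is constant on $I$, by the Abel-Liouville-Ostrogradski formula (the equation has no $u''$ term). The function $\mathcal{G}$ is what $\mathcal{F}\left(W(x,y,z)(t),W(x',y',z')(t)\right)$ becomes after the substitution $W(x',y',z')(t)=-\delta W(x,y,z)(t)$. *)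

(* Defs.v *)
From HB Require Import structures.
From mathcomp Require Import all_boot all_order all_algebra.
From mathcomp Require Import all_classical all_reals all_analysis.

Set Implicit Arguments.
Unset Strict Implicit.
Unset Printing Implicit Defensive.

Import Order.TTheory GRing.Theory Num.Theory.
Import numFieldNormedType.Exports.

Local Open Scope ring_scope.
Local Open Scope classical_set_scope.

Definition open_interval (R : realType) (I : set R) : Prop :=
  [/\ I !=set0, open I & is_interval I].

(* Functions on I are represented by total functions R -> R whose values
   outside I are irrelevant: since I is open, all derivatives at a point of I
   depend only on the values on I. *)
Definition smooth_on (R : realType) (I : set R) (f : R -> R) : Prop :=
  forall (n : nat) (t : R), I t -> derivable (f^`(n)) t 1.

(* The iterated partial derivative along the word s, where false stands for
   d/da, true stands for d/db, and the head of s is applied last. *)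
Definition direction (R : realType) (b : bool) : R * R :=
  if b then (0, 1) else (1, 0).

Definition iter_partial (R : realType) (s : seq bool) (F : R * R -> R) :
    R * R -> R :=
  foldr (fun b (G : R * R -> R) p => 'D_(direction R b) G p) F s.

(* C^oo on the plane: all iterated partial derivatives exist and are
   continuous. *)
Definition smooth2 (R : realType) (F : R * R -> R) : Prop :=
  forall s : seq bool,
    continuous (iter_partial s F) /\
    forall (b : bool) (p : R * R),
      derivable (iter_partial s F) p (direction R b).

Definition wronskian (R : realType) (x y z : R -> R) (t : R) : R :=
  \det (\matrix_(i < 3, j < 3) (tnth [tuple x; y; z] j)^`(i) t).

Definition linearly_independent_on (R : realType) (I : set R)
    (x y z : R -> R) : Prop :=
  forall a b c : R,
    (forall t, I t -> a * x t + b * y t + c * z t = 0) ->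
    [/\ a = 0, b = 0 & c = 0].

Definition solution_on (R : realType) (I : set R) (gamma : R -> R) (delta : R)
    (u : R -> R) : Prop :=
  smooth_on I u /\
  forall t, I t -> derive1n 3 u t + gamma t * derive1 u t + delta * u t = 0.

Definition compat (R : realType) (F : R * R -> R) (w delta : R) : R :=
  F (w, - delta * w).

(* Main.v *)
Require Import Defs.
From HB Require Import structures.
From mathcomp Require Import all_boot all_order all_algebra.
From mathcomp Require Import all_classical all_reals all_analysis.
From mathcomp Require Import ring.

(* The Wronskian [W] has derivative [det (u, u', u''')] and [W(x', y', z')] is
   [det (u', u'', u''')]. Substituting [u''' = - gamma u' - delta u] and
   discarding repeated rows, the first becomes [0] and the second becomes
   [- delta * det (u', u'', u) = - delta * W]. *)

Import Order.TTheory GRing.Theory Num.Theory.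
Import numFieldNormedType.Exports.

Local Open Scope ring_scope.
Local Open Scope classical_set_scope.

Lemma det_mx33 (K : comPzRingType) (A : 'M[K]_3) :
  \det A =
    A 0 0 * (A 1 1 * A 2%:R 2%:R - A 1 2%:R * A 2%:R 1)
    - A 0 1 * (A 1 0 * A 2%:R 2%:R - A 1 2%:R * A 2%:R 0)
    + A 0 2%:R * (A 1 0 * A 2%:R 1 - A 1 1 * A 2%:R 0).
Proof.
(* Indexing the entries by naturals gives the many ordinals produced by the two cofactor expansions
   a common form, so that [ring] sees equal entries as equal atoms. *)
pose a (i j : nat) := A (inord i) (inord j).
have aE i j : A i j = a i j by rewrite /a !inord_val.
rewrite (expand_det_row _ ord0) !big_ord_recl big_ord0.
rewrite /cofactor !(expand_det_row _ ord0) !big_ord_recl !big_ord0.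
rewrite /cofactor !det_mx11 !mxE !aE /bump /=.
rewrite !add0n !expr0 !expr1 sqrrN expr1n.
ring.
Qed.

Lemma wronskianE (R : realType) (x y z : R -> R) (t : R) :
  wronskian x y z t =
    x t * (derive1n 1 y t * derive1n 2 z t - derive1n 1 z t * derive1n 2 y t)
    - y t * (derive1n 1 x t * derive1n 2 z t - derive1n 1 z t * derive1n 2 x t)
    + z t * (derive1n 1 x t * derive1n 2 y t - derive1n 1 y t * derive1n 2 x t).
Proof. by rewrite /wronskian det_mx33 !mxE !(tnth_nth (fun=> 0)). Qed.

Lemma solution_derive3 {R : realType} {I : set R} {gamma : R -> R} {delta : R}
    {u : R -> R} {t : R} :
  solution_on I gamma delta u -> I t ->
  derive1n 3 u t = - gamma t * derive1n 1 u t - delta * u t.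
Proof.
move=> [_ /(_ t)] + It => /(_ It); rewrite -[derive1 u]/(derive1n 1 u).
move: (derive1n 3 u t) (derive1n 1 u t) (u t) => u3 u1 u0 e.
(* Once the right-hand [0] is replaced by the left side of the differential equation, a ring
   identity remains. *)
by apply/eqP; rewrite -subr_eq0 -e; apply/eqP; ring.
Qed.

Lemma wronskian_derive1 {R : realType} {I : set R} {gamma : R -> R} {delta : R}
    {x y z : R -> R} {t : R} :
  solution_on I gamma delta x -> solution_on I gamma delta y ->
  solution_on I gamma delta z -> I t ->
  wronskian x^`() y^`() z^`() t = - delta * wronskian x y z t.
Proof.
move=> hx hy hz It.
(* [derive1n 2 (derive1 u)] is convertible to [derive1n 3 u]. *)
have d3 u : solution_on I gamma delta u ->
    derive1n 2 (derive1 u) t = - gamma t * derive1n 1 u t - delta * u t.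
  by move=> hu; exact: solution_derive3 hu It.
rewrite !wronskianE !d3//.
(* The derivatives of [x'] and those of [x] are brought to one syntactic form, so that the
   generalisations catch every occurrence. *)
rewrite -![derive1n 1 (derive1 _)]/(derive1n 2 _) -![derive1 _]/(derive1n 1 _).
(* Otherwise [ring] unfolds [derive1n] when comparing atoms. *)
move: (derive1n 2 x t) (derive1n 1 x t) (x t) => x2 x1 x0.
move: (derive1n 2 y t) (derive1n 1 y t) (y t) => y2 y1 y0.
move: (derive1n 2 z t) (derive1n 1 z t) (z t) => z2 z1 z0.
ring.
Qed.

(** Leibniz rule on a determinant expanded along its first row, grouped into three determinants with
    one differentiated row each. The primes only label rows: no function is assumed to be the
    derivative of another. *)
Lemma is_derive_det3 {R : realType} {a b c a' b' c' a'' b'' c'' : R -> R}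
    {t da db dc da' db' dc' da'' db'' dc'' : R} :
  is_derive t 1 a da -> is_derive t 1 b db -> is_derive t 1 c dc ->
  is_derive t 1 a' da' -> is_derive t 1 b' db' -> is_derive t 1 c' dc' ->
  is_derive t 1 a'' da'' -> is_derive t 1 b'' db'' -> is_derive t 1 c'' dc'' ->
  is_derive t 1
    (fun u => a u * (b' u * c'' u - c' u * b'' u)
            - b u * (a' u * c'' u - c' u * a'' u)
            + c u * (a' u * b'' u - b' u * a'' u))
    (da * (b' t * c'' t - c' t * b'' t) - db * (a' t * c'' t - c' t * a'' t)
     + dc * (a' t * b'' t - b' t * a'' t)
     + (a t * (db' * c'' t - dc' * b'' t) - b t * (da' * c'' t - dc' * a'' t)
        + c t * (da' * b'' t - db' * a'' t))
     + (a t * (b' t * dc'' - c' t * db'') - b t * (a' t * dc'' - c' t * da'')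
        + c t * (a' t * db'' - b' t * da''))).
Proof.
move=> ha hb hc ha' hb' hc' ha'' hb'' hc''.
(* Written with operations on functions, the expression matches the sum and product rules. *)
have -> : (fun u => a u * (b' u * c'' u - c' u * b'' u)
                  - b u * (a' u * c'' u - c' u * a'' u)
                  + c u * (a' u * b'' u - b' u * a'' u)) =
    a * (b' * c'' - c' * b'') - b * (a' * c'' - c' * a'')
    + c * (a' * b'' - b' * a'') by [].
have minor (f g h k : R -> R) (df dg dh dk : R) : is_derive t 1 f df -> is_derive t 1 g dg ->
    is_derive t 1 h dh -> is_derive t 1 k dk ->
    is_derive t 1 (f * g - h * k : R -> R)
      (f t *: dg + g t *: df - (h t *: dk + k t *: dh)).
  by move=> hf hg hh hk; exact: is_deriveB (is_deriveM hf hg) (is_deriveM hh hk).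
apply: is_derive_eq (is_deriveD
  (is_deriveB (is_deriveM ha (minor _ _ _ _ _ _ _ _ hb' hc'' hc' hb''))
              (is_deriveM hb (minor _ _ _ _ _ _ _ _ ha' hc'' hc' ha'')))
  (is_deriveM hc (minor _ _ _ _ _ _ _ _ ha' hb'' hb' ha''))) _.
rewrite !fctE /= /GRing.scale /=.
ring.
Qed.

Lemma is_derive_wronskian {R : realType} {I : set R} {gamma : R -> R}
    {delta : R} {x y z : R -> R} {t : R} :
  solution_on I gamma delta x -> solution_on I gamma delta y ->
  solution_on I gamma delta z -> I t ->
  is_derive t 1 (wronskian x y z) 0.
Proof.
move=> hx hy hz It.
have isd n u : solution_on I gamma delta u ->
    is_derive t 1 (derive1n n u) (derive1n n.+1 u t).
  by move=> [su _]; apply: DeriveDef; [exact: su | rewrite /= derive1E].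
rewrite (funext (wronskianE R x y z)).
(* With rows [u], [u'], [u''], the first two determinants have a repeated row; in the third, the
   last row [u'''] is a combination of the other two, [u'] and [u]. *)
apply: is_derive_eq (is_derive_det3
  (isd 0 _ hx) (isd 0 _ hy) (isd 0 _ hz)
  (isd 1 _ hx) (isd 1 _ hy) (isd 1 _ hz)
  (isd 2 _ hx) (isd 2 _ hy) (isd 2 _ hz)) _.
rewrite (solution_derive3 hx It) (solution_derive3 hy It).
rewrite (solution_derive3 hz It) !derive1n0.
move: (derive1n 2 x t) (derive1n 1 x t) (x t) => x2 x1 x0.
move: (derive1n 2 y t) (derive1n 1 y t) (y t) => y2 y1 y0.
move: (derive1n 2 z t) (derive1n 1 z t) (z t) => z2 z1 z0.
ring.
Qed.

(** The mean value theorem applies on the segment between the two points, which lies in [I] because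
    [I] is an interval. *)
Lemma is_derive0_interval_cst {R : realType} {I : set R} {f : R -> R} :
  is_interval I -> (forall t, I t -> is_derive t 1 f 0) ->
  forall s t, I s -> I t -> f s = f t.
Proof.
move=> II df s t.
wlog st : s t / s <= t.
  by move=> H Is It; case: (leP s t) => [|/ltW] le_st; [|symmetry]; exact: H.
move=> Is It.
have Ist u : s <= u <= t -> I u by exact: II.
have [u /itvP ust||c _] := @MVT_segment R f (fun=> 0) s t st.
- by apply: df; apply: Ist; rewrite !ust.
- apply: derivable_within_continuous => u /itvP ust.
  by have [] := df u (Ist u _); rewrite ?ust.
- by rewrite mul0r => /eqP; rewrite subr_eq0 => /eqP.
Qed.

Theorem theorem2p1 (R : realType) (I : set R) (gamma : R -> R) (delta : R)
    (F : R * R -> R) (x y z : R -> R)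
    (hI : open_interval I)
    (hgamma : smooth_on I gamma)
    (hdelta : delta != 0)
    (hF : smooth2 F)
    (hx : solution_on I gamma delta x)
    (hy : solution_on I gamma delta y)
    (hz : solution_on I gamma delta z)
    (hindep : linearly_independent_on I x y z)
    (hW : forall t, I t -> wronskian x y z t != 0)
    (hW' : forall t, I t -> wronskian x^`() y^`() z^`() t != 0) :
  (exists C0 : R, forall t, I t -> wronskian x y z t = C0) /\
  (forall C0 : R,
    (forall t, I t -> wronskian x y z t = C0) ->
    compat F C0 delta = 0 ->
    forall t, I t ->
      F (wronskian x y z t, wronskian x^`() y^`() z^`() t) = 0).
Proof.
have [[t0 It0] _ Iitv] := hI; split.
  (* The constant is the value at any point of the nonempty [I]. *)
  exists (wronskian x y z t0) => t It.
  apply: (is_derive0_interval_cst Iitv) => // u Iu.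
  exact: is_derive_wronskian hx hy hz Iu.
move=> C0 hC0 hG t It.
(* The goal becomes [F (C0, - delta * C0) = 0], which is [hG] unfolded. *)
by rewrite (wronskian_derive1 hx hy hz It) hC0.
Qed.
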